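(* Let $d\ge1$ and let $f(\theta)=P(\theta)=\sum_{k=-d}^{d}a_k e^{ik\theta}$ be a trigonometric polynomial with $a_{-k}=\overline{a_k}$ for $-d\le k\le d$. Then for every irrational $\alpha\in\mathbb{R}\setminus\mathbb{Q}$ and every $E\in\mathbb{R}$, \[ \bar\gamma(E,\alpha)\ \ge\ \ln_+|a_d|. \]
   Context: For $\alpha\in\mathbb{R}$, $0\le\theta<2\pi$ set $V_{\alpha,\theta}(n)=f(2\pi\alpha n+\theta)$ for $n\ge1$. For $E\in\mathbb{R}$ the transfer matrices are $T_n(E,\alpha,\theta)=\begin{pmatrix} E-V_{\alpha,\theta}(n) & -1\\ 1 & 0\end{pmatrix}$ and $\Phi_n(E,\alpha,\theta)=T_n(E,\alpha,\theta)\cdots T_2(E,\alpha,\theta)T_1(E,\alpha,\theta)$. The Lyapunov exponent is $\bar\gamma(E,\alpha)=\lim_{n\to\infty}\frac1n\cdot\frac{1}{2\pi}\int_0^{2\pi}\ln\|\Phi_n(E,\alpha,\theta)\|\,d\theta$. Here $\ln_+x=\max(\ln x,0)$ for $x>0$ and $\ln_+0=0$. *)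

(* Defs.v *)
From HB Require Import structures.
From mathcomp Require Export all_boot all_order all_algebra.
From mathcomp Require Export complex.
From mathcomp Require Export all_classical all_reals all_analysis.
Set Implicit Arguments.
Unset Strict Implicit.
Unset Printing Implicit Defensive.
Export Order.TTheory GRing.Theory Num.Theory.
Export numFieldNormedType.Exports.
Local Open Scope classical_set_scope.
Local Open Scope ring_scope.
Local Open Scope complex_scope.

(* e^{i t} for real t *)
Definition expi (R : realType) (t : R) : R[i] := cos t +i* sin t.

(* The frequency is k = j - d, so k runs over -d, ..., d as j runs over
   0, ..., 2d; values of a outside this range are not used. *)
Definition trig_poly (R : realType) (d : nat) (a : int -> R[i]) (t : R)
    : R[i] :=
  \sum_(j < (2 * d).+1) let k : int := j%:Z - d%:Z in a k * expi (k%:~R * t).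

Definition lnp (R : realType) (x : R) : R :=
  if 0 < x then Num.max (ln x) 0 else 0.

Definition l2norm (R : realType) (n : nat) (v : 'cV[R]_n) : R :=
  Num.sqrt (\sum_(i < n) v i 0 ^+ 2).

(* Operator norm induced by the Euclidean norm (the library norm on matrices
   is the maximum of the absolute values of the entries). *)
Definition opnorm (R : realType) (n : nat) (M : 'M[R]_n) : R :=
  sup [set l2norm (M *m v) | v in [set v : 'cV[R]_n | l2norm v <= 1]].

Definition potential (R : realType) (f : R -> R) (alpha theta : R) (n : nat)
    : R :=
  f (2 * pi * alpha * n%:R + theta).

Definition transfer (R : realType) (f : R -> R) (E alpha theta : R) (n : nat)
    : 'M[R]_2 :=
  \matrix_(i < 2, j < 2)
    nth 0 (nth [::] [:: [:: E - potential f alpha theta n; -1];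
                        [:: 1;                             0 ]] i) j.

(* Phi_n = T_n ... T_2 T_1 *)
Fixpoint Phi (R : realType) (f : R -> R) (E alpha theta : R) (n : nat)
    : 'M[R]_2 :=
  if n is m.+1 then transfer f E alpha theta n *m Phi f E alpha theta m
  else 1%:M.

Definition lyapunov_seq (R : realType) (f : R -> R) (E alpha : R) (n : nat)
    : R :=
  n%:R^-1 * ((2 * pi)^-1 *
    \int[lebesgue_measure]_(theta in `[0, 2 * pi])
      ln (opnorm (Phi f E alpha theta n))).

Definition lyapunov (R : realType) (f : R -> R) (E alpha : R) : R :=
  lim (lyapunov_seq f E alpha @ \oo).

(* Main.v *)
(* The limit exists by Fekete's lemma: ln ||Phi_n|| is subadditive along the
   rotation theta -> theta + 2 pi alpha, and it is nonnegative as
   det Phi_n = 1. So it suffices to bound the mean of ln ||Phi_n|| below by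
   n ln |a_d| for each n. Following Herman, e^{i n d theta} times the upper
   left entry of Phi_n is a polynomial X in z = e^{i theta} with
   |X(0)| = |a_d|^n, so the bound is Jensen's inequality
   ln |X(0)| <= mean of ln |X| over the unit circle.
   The zeros of X on the circle are avoided by discretizing: the product of N
   rotations of X is a polynomial with value X(0)^N at 0, hence its modulus is
   at least |X(0)|^N somewhere on the circle, which bounds a Riemann sum of the
   continuous function ln ||Phi_n|| from below. *)

Require Import Defs.
From mathcomp Require Import ring lra.
Set Implicit Arguments.
Unset Strict Implicit.
Unset Printing Implicit Defensive.
Local Open Scope classical_set_scope.
Local Open Scope ring_scope.
Local Open Scope complex_scope.

(** * Integrals and Riemann sums of continuous periodic functions *)

Section RealAnalysis.
Variable R : realType.
Implicit Types (g : R -> R) (a b c s t : R).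
Local Notation mu := (@lebesgue_measure R).

Lemma continuous_itv_integrable g a b : continuous g ->
  mu.-integrable `[a, b] (EFin \o g).
Proof.
move=> cg; apply: continuous_compact_integrable; first exact: segment_compact.
exact: continuous_subspaceT.
Qed.

Lemma Rintegral_itv_cat g a b c : continuous g -> a <= b -> b <= c ->
  \int[mu]_(x in `[a, c]) g x =
  \int[mu]_(x in `[a, b]) g x + \int[mu]_(x in `[b, c]) g x.
Proof.
move=> cg ab bc.
have H := @Rintegral_itvB R g (BLeft a) (BRight c) b
  (continuous_itv_integrable _ _ cg).
rewrite -[LHS](subrK (\int[mu]_(x in `[a, b]) g x)) H ?bnd_simp// addrC.
congr (_ + _); rewrite Rintegral_itv_obnd_cbnd//.
apply: integrableS (continuous_itv_integrable b c cg) => //.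
exact: subset_itv_oc_cc.
Qed.

Lemma Rintegral_itv_shift g a b s : continuous g -> a <= b ->
  \int[mu]_(x in `[a, b]) g (x + s) = \int[mu]_(x in `[a + s, b + s]) g x.
Proof.
move=> cg ab; rewrite /Rintegral; congr fine; apply/esym.
have D : derive1 (fun x : R => x + s) = cst 1.
  by apply/funext => x; rewrite derive1E deriveD// derive_id derive_cst addr0.
rewrite (@integration_by_substitution_increasing R (fun x => x + s) g a b) ?D//.
- by apply: eq_integral => x _; rewrite /= mulr1.
- by move=> x y _ _; rewrite ltrD2r.
- by move=> x _; exact: cvg_cst.
- exact: is_cvg_cst.
- exact: is_cvg_cst.
- have cs : continuous (fun x : R => x + s).
    by move=> x; apply: cvgD; [exact: cvg_id|exact: cvg_cst].
  split; first by move=> x _; apply: derivableD.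
  + exact: cvg_at_right_filter (cs a).
  + exact: cvg_at_left_filter (cs b).
- exact: continuous_subspaceT.
Qed.

Lemma le_Rintegral_itv g h a b : continuous g -> continuous h ->
  (forall x, x \in `[a, b] -> g x <= h x) ->
  \int[mu]_(x in `[a, b]) g x <= \int[mu]_(x in `[a, b]) h x.
Proof.
move=> cg ch gh; apply: le_Rintegral => //; exact: continuous_itv_integrable.
Qed.

Lemma Rintegral_itv_cst a b c : a <= b ->
  \int[mu]_(_ in `[a, b]) c = c * (b - a).
Proof.
move=> ab; rewrite Rintegral_cst//.
rewrite /= lebesgue_measure_itv/= lte_fin.
by move: ab; rewrite le_eqVlt => /predU1P[->|->]; rewrite ?ltxx ?subrr.
Qed.

Lemma periodicz (V : zmodType) (g : R -> V) T (k : int) :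
  periodic g T -> forall x, g (x + k%:~R * T) = g x.
Proof.
move=> gT x; case: k => n; first by rewrite -[n%:~R]/(n%:R) mulr_natl periodicn.
rewrite NegzE mulrNz mulNr -[in RHS](subrK (n.+1%:R * T) x).
by rewrite mulr_natl periodicn.
Qed.

Lemma modr_period s T : 0 < T ->
  exists (k : int) r, s = r + k%:~R * T /\ 0 <= r <= T.
Proof.
move=> T0; pose k := Num.floor (s / T); exists k, (s - k%:~R * T).
split; first by rewrite subrK.
rewrite subr_ge0 -ler_pdivlMr// Num.Theory.floor_le/= lerBlDr.
have -> : T + k%:~R * T = (k + 1)%:~R * T by rewrite intrD mulrDl mul1r addrC.
by rewrite -ler_pdivrMr// ltW// Num.Theory.floorD1_gt.
Qed.

(** Reduce [s] modulo [T] to some [r] in [[0, T]], split the window [[r, r + T]] at [T], and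
    translate the piece beyond [T] back onto [[0, r]]. *)
Lemma Rintegral_periodic g T s : continuous g -> 0 < T -> periodic g T ->
  \int[mu]_(x in `[s, s + T]) g x = \int[mu]_(x in `[0, T]) g x.
Proof.
move=> cg T0 gT; have [k [r [-> /andP[r0 rT]]]] := modr_period s T0.
have -> : \int[mu]_(x in `[r + k%:~R * T, r + k%:~R * T + T]) g x =
    \int[mu]_(x in `[r, r + T]) g x.
  rewrite addrAC -(Rintegral_itv_shift _ cg) ?lerDl ?ltW//.
  by apply: eq_Rintegral => x _; rewrite periodicz.
rewrite (@Rintegral_itv_cat _ r T) ?lerDr//.
have := Rintegral_itv_shift T cg r0; rewrite add0r => <-.
rewrite (_ : \int[mu]_(x in `[0, r]) g (x + T) = \int[mu]_(x in `[0, r]) g x).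
  by rewrite addrC -Rintegral_itv_cat.
by apply: eq_Rintegral => x _; rewrite gT.
Qed.

(** Heine-Cantor by compactness, in near-covering form. Only [x] is confined to the segment: [y] may
    leave it, which is what the periodic version requires. *)
Lemma continuous_unif_itv g a b e : continuous g -> 0 < e ->
  exists2 d, 0 < d & forall x y, x \in `[a, b] -> `|y - x| < d ->
    `|g y - g x| < e.
Proof.
move=> cg e0.
have /compact_near_coveringP ncov := @segment_compact R a b.
have unif x : `[a, b]%classic x -> \forall x' \near x & d \near 0^'+,
    forall y, `|y - x'| < d -> `|g y - g x'| < e.
  move=> _.
  have e20 : 0 < e / 2 by rewrite divr_gt0.
  have /cvgrPdist_lt/(_ _ e20)/nbhs_ballP[r /= r0 H] := cg x.
  near=> z d => /= y yzd.
  have zx : ball x (r / 2) z by near: z; apply: nbhsx_ballx; rewrite divr_gt0.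
  have dr : d < r / 2 by near: d; apply: nbhs_right_lt; rewrite divr_gt0.
  have gz : `|g x - g z| < e / 2.
    by apply: H; apply: le_ball zx; lra.
  have gy : `|g x - g y| < e / 2.
    apply: H; move: zx; rewrite -!ball_normE/= => zx.
    have := ler_distD z x y; rewrite (distrC z y).
    lra.
  have := ler_distD (g x) (g y) (g z); rewrite (distrC (g y) (g x)).
  lra.
have H := ncov R (0^'+) (fun d x => forall y, `|y - x| < d -> `|g y - g x| < e)
  _ unif.
near (0 : R)^'+ => d.
have Hd : `[a, b]%classic `<=`
    (fun x => forall y, `|y - x| < d -> `|g y - g x| < e).
  by near: d; exact: H.
by exists d => // x y xab; exact: Hd.
Unshelve. all: by end_near.
Qed.

(** Translating [x] and [y] by the same multiple of [T] brings [x] into [[0, T]] and preserves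
    [y - x]. *)
Lemma periodic_unif_continuous g T e : continuous g -> 0 < T -> periodic g T ->
  0 < e ->
  exists2 d, 0 < d & forall x y, `|y - x| < d -> `|g y - g x| < e.
Proof.
move=> cg T0 gT e0; have [d d0 gd] := continuous_unif_itv 0 T cg e0.
exists d => // x y; have [k [r [-> r0T]]] := modr_period x T0.
rewrite -[y](subrK (k%:~R * T)) !(periodicz _ gT) => yxd.
apply: gd; first by rewrite in_itv/= r0T.
by move: yxd; rewrite opprD addrACA subrr addr0.
Qed.

(** Left Riemann sum: on each cell of length [h], [g] falls below its value at the left end by at
    most [e]. *)
Lemma Rintegral_ge_sum g e h t (n : nat) : continuous g -> 0 <= h ->
  (forall x y, `|y - x| <= h -> `|g y - g x| <= e) ->
  h * \sum_(k < n) (g (t + k%:R * h) - e) <=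
  \int[mu]_(x in `[t, t + n%:R * h]) g x.
Proof.
move=> cg h0 ge; elim: n => [|n IH].
  by rewrite big_ord0 mulr0 mul0r addr0 set_itv1 Rintegral_set1.
rewrite big_ord_recr/= mulrDr.
have nh : t <= t + n%:R * h by rewrite lerDl mulr_ge0.
have nSh : t + n.+1%:R * h = t + n%:R * h + h.
  by rewrite -addrA -[n.+1]addn1 natrD mulrDl mul1r.
have nSh' : t + n%:R * h <= t + n.+1%:R * h by rewrite nSh lerDl.
rewrite (Rintegral_itv_cat cg nh nSh') lerD//.
have -> : h * (g (t + n%:R * h) - e) =
    \int[mu]_(x in `[t + n%:R * h, t + n.+1%:R * h]) (g (t + n%:R * h) - e).
  by rewrite Rintegral_itv_cst// nSh; ring.
apply: le_Rintegral_itv => //; first by move=> x; exact: cvg_cst.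
move=> x; rewrite in_itv/= nSh => /andP[x1 x2].
have : `|g x - g (t + n%:R * h)| <= e by apply: ge; rewrite ger0_norm; lra.
by rewrite ler_norml => /andP[]; lra.
Qed.

(** The base point [t] may depend on [N], since the integral over a period does not depend on where
    the period starts. A tolerance [e / T] per cell costs [e] in total. *)
Lemma Rintegral_periodic_ge g T L : continuous g -> 0 < T -> periodic g T ->
  (forall N, (0 < N)%N ->
    exists t, N%:R * L <= \sum_(k < N) g (t + k%:R * (T / N%:R))) ->
  T * L <= \int[mu]_(x in `[0, T]) g x.
Proof.
move=> cg T0 gT gL; apply/ler_addgt0Pr => e e0.
have [d d0 gd] := periodic_unif_continuous cg T0 gT (divr_gt0 e0 T0).
(* The successor makes [N] exceed [T / d], so the mesh [T / N] is below the modulus [d]. *)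
pose N := (Num.truncn (T / d)).+1.
have N0 : 0 < N%:R :> R by rewrite ltr0n.
have hd : T / N%:R < d.
  by rewrite ltr_pdivrMr// mulrC -ltr_pdivrMr// truncnS_gt.
have [t Nt] := gL N isT.
have h0 : 0 <= T / N%:R by rewrite divr_ge0// ltW.
have := @Rintegral_ge_sum g (e / T) (T / N%:R) t N cg h0.
rewrite mulrCA divff ?gt_eqF// mulr1 Rintegral_periodic// => H.
have {}H := H (fun x y xy => ltW (gd x y (le_lt_trans xy hd))).
rewrite -lerBlDr (le_trans _ H)// sumrB sumr_const card_ord.
rewrite -[e / T *+ N]mulr_natl.
have -> : T * L - e = T / N%:R * (N%:R * L - N%:R * (e / T)).
  by field; rewrite !gt_eqF.
by rewrite ler_wpM2l// lerD2r.
Qed.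

(** * Fekete's lemma for nonnegative subadditive sequences *)

Section Fekete.
Variable u : nat -> R.
Hypothesis u_ge0 : forall n, 0 <= u n.
Hypothesis u_subadd : forall m n, u (m + n)%N <= u m + u n.

Lemma subadditive_iter q m r : u (q * m + r)%N <= q%:R * u m + u r.
Proof.
elim: q => [|q IH]; first by rewrite mul0r add0r.
rewrite mulSn -addnA (le_trans (u_subadd _ _))//.
by rewrite -[q.+1]add1n natrD mulrDl mul1r -addrA lerD2l.
Qed.

(** The limit is the infimum of [u n / n] over positive [n]. Past a near-minimizer [m.+1], Euclidean
    division of [n] by [m.+1] leaves a remainder term that is negligible after division by [n]. *)
Lemma fekete : cvgn (fun n => n%:R^-1 * u n).
Proof.
pose S := [set n.+1%:R^-1 * u n.+1 | n in setT].
have S0 : lbound S 0 by move=> _ [n _ <-]; rewrite mulr_ge0.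
have Sinf : has_inf S by split; [exists (1%:R^-1 * u 1%N), 0%N | exists 0].
apply/cvg_ex; exists (inf S); apply/cvgrPdist_lt => e e0.
have e20 : 0 < e / 2 by rewrite divr_gt0.
have [_ [m _ <-] mlt] := inf_adherent e20 Sinf.
(* A bound, independent of [n], for [u] at every remainder modulo [m.+1]. *)
pose B := \sum_(r < m.+1) u r.
have uB r : (r < m.+1)%N -> u r <= B.
  by move=> rm; rewrite /B (bigD1 (Ordinal rm))//= lerDl sumr_ge0.
near=> n.
have n0 : (0 < n)%N by near: n; exact: nbhs_infty_gt.
have n0R : 0 < n%:R :> R by rewrite ltr0n.
have nB : n%:R^-1 * B < e / 2.
  rewrite mulrC ltr_pdivrMr// mulrC -ltr_pdivrMr//.
  by near: n; exact: nbhs_infty_gtr.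
have lo : inf S <= n%:R^-1 * u n.
  by apply: ge_inf; [exists 0 | exists n.-1; rewrite ?prednK].
have hi : n%:R^-1 * u n <= m.+1%:R^-1 * u m.+1 + n%:R^-1 * B.
  rewrite -(ler_pM2l n0R) mulrDr !mulVKf ?gt_eqF//.
  rewrite {1}(divn_eq n m.+1) (le_trans (subadditive_iter _ _ _))//.
  apply: lerD; last by rewrite uB// ltn_pmod.
  rewrite mulrA ler_wpM2r// ler_pdivlMr ?ltr0n// -natrM ler_nat.
  exact: leq_trunc_div.
rewrite ler0_norm ?subr_le0// opprB.
move: (n%:R^-1 * u n) (m.+1%:R^-1 * u m.+1) (n%:R^-1 * B) lo hi mlt nB.
by move=> x y z; lra.
Unshelve. all: by end_near.
Qed.
End Fekete.

End RealAnalysis.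

(** * Polynomials on the unit circle, averaged over roots of unity *)

Section ComplexAnalysis.
Variable R : realType.
Implicit Types (s t : R) (z : R[i]).

Lemma expiD s t : expi (s + t) = expi s * expi t.
Proof.
by apply/eqP; rewrite eq_complex /expi cosD sinD/= eqxx addrC eqxx.
Qed.

Lemma expi0 : expi 0 = 1 :> R[i].
Proof. by rewrite /expi cos0 sin0. Qed.

Lemma expiMn t n : expi (n%:R * t) = expi t ^+ n.
Proof.
elim: n => [|n IH]; first by rewrite mul0r expi0.
by rewrite -[n.+1]add1n natrD mulrDl mul1r expiD IH exprS.
Qed.

Lemma normr_expi t : `|expi t| = 1.
Proof. by rewrite normc_def/= cos2Dsin2 sqrtr1. Qed.

Lemma expi2pi : expi (2 * pi) = 1 :> R[i].
Proof. by rewrite /expi mulr_natl cos2pi sin2pi. Qed.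

(** The real part is [1 - 2 * sin (t / 2) ^+ 2], and [sin] is positive on [(0, pi)]. *)
Lemma expi_neq1 t : 0 < t < 2 * pi -> expi t != 1.
Proof.
move=> /andP[t0 tpi]; rewrite eq_complex/= negb_and; apply/orP; left.
have s0 : 0 < sin (t / 2) by apply: sin_gt0_pi; lra.
have -> : t = (t / 2) *+ 2 by rewrite -mulr_natr divfK.
rewrite cos_mulr2n cos2sin2 lt_eqF//.
have : 0 < sin (t / 2) ^+ 2 by rewrite exprn_gt0.
by lra.
Qed.

(** A geometric sum whose ratio [w] satisfies [w ^+ M = 1] and [w != 1]. *)
Lemma sum_expi_root (M j : nat) : (0 < j < M)%N ->
  \sum_(m < M) expi (m%:R * (2 * pi / M%:R)) ^+ j = 0 :> R[i].
Proof.
move=> /andP[j0 jM]; have M0 : (0 < M)%N by exact: leq_trans jM.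
have M0R : 0 < M%:R :> R by rewrite ltr0n.
have pi0 := @pi_gt0 R.
pose w : R[i] := expi (2 * pi / M%:R) ^+ j.
have wM : w ^+ M = 1.
  rewrite /w exprAC -expiMn mulrCA divff ?gt_eqF// mulr1 expi2pi.
  by rewrite expr1n.
have w1 : w != 1.
  rewrite /w -expiMn; apply: expi_neq1; apply/andP; split.
    by rewrite mulr_gt0 ?ltr0n// divr_gt0// mulr_gt0.
  rewrite mulrCA gtr_pMr ?mulr_gt0// ltr_pdivrMr// mul1r.
  by rewrite ltr_nat.
under eq_bigr do rewrite expiMn exprAC.
apply/eqP; have := subrX1 w M; rewrite wM subrr => /esym/eqP.
by rewrite mulf_eq0 subr_eq0 (negbTE w1).
Qed.

(** Discrete mean value property: averaging over the [M]-th roots of unity kills every monomial of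
    degree strictly between 0 and [M]. *)
Lemma poly_root_mean (p : {poly R[i]}) (M : nat) : (size p <= M)%N ->
  \sum_(m < M) p.[expi (m%:R * (2 * pi / M%:R))] = M%:R * p.[0].
Proof.
move=> pM.
under eq_bigr do rewrite (horner_coef_wide _ pM).
rewrite exchange_big/= horner_coef0.
case: M pM => [|M] pM; first by rewrite !big_ord0 mul0r.
rewrite big_ord_recl/= [X in _ + X]big1 ?addr0.
  by under eq_bigr do rewrite expr0 mulr1; rewrite sumr_const card_ord mulr_natl.
move=> j _; rewrite -mulr_sumr sum_expi_root ?mulr0//.
by rewrite /= /bump/= add1n ltnS.
Qed.

Lemma poly_max_circle (p : {poly R[i]}) : exists t, `|p.[0]| <= `|p.[expi t]|.
Proof.
(* The successor keeps [M] positive even for [p = 0]; the strict inequality between sums requires a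
   nonempty index set. *)
pose M := (size p).+1.
apply: contrapT => H.
have : `|\sum_(m < M) p.[expi (m%:R * (2 * pi / M%:R))]| < M%:R * `|p.[0]|.
  apply: le_lt_trans (ler_norm_sum _ _ _) _.
  have -> : M%:R * `|p.[0]| = \sum_(m < M) `|p.[0]|.
    by rewrite sumr_const card_ord mulr_natl.
  apply: ltr_sum; first by apply/hasP; exists ord0 => //; rewrite mem_index_enum.
  move=> m _; rewrite real_ltNge ?normr_real//; apply/negP => h; apply: H.
  by eexists; exact: h.
by rewrite poly_root_mean ?leqnSn// normrM normr_nat ltxx.
Qed.

(* The rotations of [p] by multiples of [h] multiply to a polynomial whose
   value at [0] is [p(0) ^ N]. *)
Lemma poly_prod_rotation (p : {poly R[i]}) (N : nat) (h : R) :
  exists t, `|p.[0]| ^+ N <= \prod_(k < N) `|p.[expi (t + k%:R * h)]|.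
Proof.
pose Q := \prod_(k < N) (p \Po ((expi (k%:R * h)) *: 'X)).
have [t Qt] := poly_max_circle Q; exists t; move: Qt.
rewrite /Q !horner_prod !normr_prod.
under eq_bigr do rewrite horner_comp hornerZ hornerX mulr0.
rewrite prodr_const card_ord => /le_trans; apply.
rewrite le_eqVlt; apply/orP; left; apply/eqP; apply: eq_bigr => k _.
by rewrite horner_comp hornerZ hornerX -expiD addrC.
Qed.

End ComplexAnalysis.

(** * The Euclidean operator norm *)

Section OperatorNorm.
Variable R : realType.
Section GeneralSize.
Variable n : nat.
Implicit Types (u v : 'cV[R]_n) (A B : 'M[R]_n).

Lemma l2norm_ge0 v : 0 <= l2norm v.
Proof. exact: sqrtr_ge0. Qed.

Lemma sqr_l2norm v : l2norm v ^+ 2 = \sum_(i < n) v i 0 ^+ 2.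
Proof. by rewrite sqr_sqrtr// sumr_ge0// => i _; exact: sqr_ge0. Qed.

Lemma l2norm0 : l2norm (0 : 'cV[R]_n) = 0.
Proof.
by apply/eqP; rewrite -sqrf_eq0 sqr_l2norm big1// => i _; rewrite mxE expr0n.
Qed.

Lemma l2norm_eq0 v : l2norm v = 0 -> v = 0.
Proof.
move=> /(congr1 (fun x => x ^+ 2)); rewrite sqr_l2norm expr0n => /eqP.
rewrite psumr_eq0 => [/allP h|i _]; last exact: sqr_ge0.
apply/colP => i; rewrite mxE; apply/eqP.
by rewrite -sqrf_eq0; apply: (h i); rewrite mem_index_enum.
Qed.

Lemma l2normZ (c : R) v : l2norm (c *: v) = `|c| * l2norm v.
Proof.
apply/eqP; rewrite -(eqrXn2 (n := 2))// ?mulr_ge0// ?l2norm_ge0//.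
rewrite exprMn !sqr_l2norm real_normK ?num_real// mulr_sumr.
by apply/eqP; apply: eq_bigr => i _; rewrite mxE exprMn.
Qed.

Lemma l2norm_entry v i : `|v i 0| <= l2norm v.
Proof.
rewrite -(ler_pXn2r (n := 2)) ?nnegrE ?l2norm_ge0//.
rewrite sqr_l2norm real_normK ?num_real// (bigD1 i)//= lerDl.
by apply: sumr_ge0 => j _; exact: sqr_ge0.
Qed.

(** Expand the squared length of [l2norm v *: u - l2norm u *: v], which is nonnegative, and divide
    by [2 * l2norm u * l2norm v]; zero vectors are treated apart. *)
Lemma cauchy_schwarz u v : \sum_(i < n) u i 0 * v i 0 <= l2norm u * l2norm v.
Proof.
have [u0|u0] := eqVneq (l2norm u) 0.
  by rewrite u0 mul0r (l2norm_eq0 u0) big1// => i _; rewrite mxE mul0r.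
have [v0|v0] := eqVneq (l2norm v) 0.
  by rewrite v0 mulr0 (l2norm_eq0 v0) big1// => i _; rewrite mxE mulr0.
have uv : 0 < l2norm u * l2norm v by rewrite mulr_gt0// lt_def l2norm_ge0 ?u0 ?v0.
have : 0 <= \sum_(i < n) (l2norm v * u i 0 - l2norm u * v i 0) ^+ 2.
  by apply: sumr_ge0 => i _; exact: sqr_ge0.
under eq_bigr do rewrite sqrrB !exprMn.
rewrite big_split sumrB/= -!mulr_sumr -!sqr_l2norm.
under eq_bigr do rewrite mulrACA -mulrnAr.
rewrite -mulr_sumr sumrMnl => h.
rewrite -(ler_pM2l uv).
lra.
Qed.

Lemma l2normD u v : l2norm (u + v) <= l2norm u + l2norm v.
Proof.
rewrite -(ler_pXn2r (n := 2)) ?nnegrE ?addr_ge0 ?l2norm_ge0//.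
rewrite sqrrD !sqr_l2norm.
under eq_bigr do rewrite mxE sqrrD.
rewrite !big_split/= -mulr2n lerD2r lerD2l lerMn2r/=.
exact: cauchy_schwarz.
Qed.

(** A crude bound, but enough to make the supremum in [opnorm] finite and to deduce continuity of
    [opnorm] from that of the entries. *)
Lemma l2norm_mulmx_le A v :
  l2norm (A *m v) <= (\sum_(i < n) \sum_(j < n) `|A i j|) * l2norm v.
Proof.
have S0 : 0 <= \sum_(i < n) \sum_(j < n) `|A i j|.
  by do 2 (apply: sumr_ge0 => ? _).
have l1 (w : 'cV[R]_n) : l2norm w <= \sum_(i < n) `|w i 0|.
  have W0 : 0 <= \sum_(i < n) `|w i 0| by apply: sumr_ge0.
  rewrite -(ler_pXn2r (n := 2)) ?nnegrE ?l2norm_ge0//.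
  rewrite sqr_l2norm expr2 mulr_suml; apply: ler_sum => i _.
  rewrite -real_normK ?num_real// expr2 ler_wpM2l// (bigD1 i)//= lerDl.
  exact: sumr_ge0.
apply: le_trans (l1 _) _; rewrite mulr_suml; apply: ler_sum => i _.
rewrite mxE mulr_suml; apply: le_trans (ler_norm_sum _ _ _) _.
by apply: ler_sum => j _; rewrite normrM ler_wpM2l// l2norm_entry.
Qed.

Lemma opnorm_has_sup A :
  has_sup [set l2norm (A *m v) | v in [set v : 'cV[R]_n | l2norm v <= 1]].
Proof.
split; first by exists (l2norm (A *m 0)), 0; rewrite //= l2norm0.
exists (\sum_(i < n) \sum_(j < n) `|A i j|) => _ [v /= v1 <-].
apply: le_trans (l2norm_mulmx_le _ _) _; rewrite ler_piMr//.
by do 2 (apply: sumr_ge0 => ? _).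
Qed.

Lemma opnorm_ge0 A : 0 <= opnorm A.
Proof.
have -> : 0 = l2norm (A *m 0) by rewrite mulmx0 l2norm0.
apply: ub_le_sup; first by case: (opnorm_has_sup A).
by exists 0; rewrite //= l2norm0.
Qed.

Lemma l2norm_mulmx A v : l2norm (A *m v) <= opnorm A * l2norm v.
Proof.
have [v0|v0] := eqVneq (l2norm v) 0.
  by rewrite v0 mulr0 (l2norm_eq0 v0) mulmx0 l2norm0.
have v_gt0 : 0 < l2norm v by rewrite lt_def v0 l2norm_ge0.
rewrite -ler_pdivrMr// mulrC -[X in X * _]ger0_norm ?invr_ge0 ?l2norm_ge0//.
rewrite -l2normZ scalemxAr.
apply: ub_le_sup; first by case: (opnorm_has_sup A).
exists ((l2norm v)^-1 *: v) => //=.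
by rewrite l2normZ ger0_norm ?invr_ge0 ?l2norm_ge0// mulVf.
Qed.

Lemma opnorm_le A (c : R) : 0 <= c ->
  (forall v, l2norm (A *m v) <= c * l2norm v) -> opnorm A <= c.
Proof.
move=> c0 h; apply: ge_sup; first by case: (opnorm_has_sup A).
move=> _ [v /= v1 <-]; apply: le_trans (h v) _.
by rewrite ler_piMr.
Qed.

Lemma opnorm_mulmx A B : opnorm (A *m B) <= opnorm A * opnorm B.
Proof.
apply: opnorm_le; first by rewrite mulr_ge0 ?opnorm_ge0.
move=> v; rewrite -mulmxA -mulrA (le_trans (l2norm_mulmx _ _))//.
by rewrite ler_wpM2l ?opnorm_ge0 ?l2norm_mulmx.
Qed.

Lemma opnormD A B : opnorm (A + B) <= opnorm A + opnorm B.
Proof.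
apply: opnorm_le; first by rewrite addr_ge0 ?opnorm_ge0.
move=> v; rewrite mulmxDl mulrDl (le_trans (l2normD _ _))//.
by rewrite lerD ?l2norm_mulmx.
Qed.

Lemma opnorm_le_sum A : opnorm A <= \sum_(i < n) \sum_(j < n) `|A i j|.
Proof.
apply: opnorm_le; first by do 2 (apply: sumr_ge0 => ? _).
exact: l2norm_mulmx_le.
Qed.

Lemma opnorm_dist A B :
  `|opnorm A - opnorm B| <= \sum_(i < n) \sum_(j < n) `|A i j - B i j|.
Proof.
have half (C D : 'M[R]_n) :
    opnorm C - opnorm D <= \sum_(i < n) \sum_(j < n) `|C i j - D i j|.
  have := opnormD (C - D) D; rewrite subrK -lerBlDr => /le_trans; apply.
  apply: le_trans (opnorm_le_sum _) _.
  by apply: ler_sum => i _; apply: ler_sum => j _; rewrite !mxE.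
rewrite ler_norml half andbT lerNl opprB (le_trans (half _ _))//.
by apply: ler_sum => i _; apply: ler_sum => j _; rewrite distrC.
Qed.

Lemma l2norm_delta i : l2norm (delta_mx i 0 : 'cV[R]_n) = 1.
Proof.
apply/eqP; rewrite -(eqrXn2 (n := 2))// ?l2norm_ge0// sqr_l2norm expr1n.
rewrite (bigD1 i)//= mxE !eqxx expr1n big1 ?addr0// => j ji.
by rewrite mxE (negbTE ji) expr0n.
Qed.

Lemma l2norm_col A j : l2norm (col j A) <= opnorm A.
Proof. by rewrite colE (le_trans (l2norm_mulmx _ _))// l2norm_delta mulr1. Qed.

Lemma opnorm_entry A i j : `|A i j| <= opnorm A.
Proof.
apply: le_trans (l2norm_col A j).
by have := l2norm_entry (col j A) i; rewrite mxE.
Qed.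

Lemma opnorm_continuous (F : R -> 'M[R]_n) :
  (forall i j, continuous (fun x => F x i j)) ->
  continuous (fun x => opnorm (F x)).
Proof.
move=> cF x.
have cvg0 : \sum_(i < n) \sum_(j < n) `|F y i j - F x i j| @[y --> x] --> 0.
  rewrite [X in _ --> X](_ : _ = \sum_(i < n) \sum_(j < n) `|F x i j - F x i j|).
    apply: cvg_big => [|i _]; first exact: add_continuous.
    apply: cvg_big => [|j _]; first exact: add_continuous.
    apply: cvg_norm.
    by apply: cvgB; [exact: cF | exact: cvg_cst].
  by rewrite big1// => i _; rewrite big1// => j _; rewrite subrr normr0.
apply/cvgrPdist_lt => e e0.
have := cvg0; move=> /cvgrPdist_lt/(_ _ e0); apply: filterS => y.
rewrite sub0r normrN; apply: le_lt_trans.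
by rewrite distrC (le_trans (opnorm_dist _ _))// ler_norm.
Qed.

End GeneralSize.

Lemma det_mx22 (A : 'M[R]_2) : \det A = A 0 0 * A 1 1 - A 0 1 * A 1 0.
Proof.
rewrite (expand_det_row _ 0) !big_ord_recl big_ord0 addr0 /cofactor !det_mx11 !mxE.
rewrite /= expr0 mul1r expr1 mulN1r mulrN.
by congr (A _ _ * A _ _ - A _ _ * A _ _); exact: val_inj.
Qed.

(** Hadamard's inequality bounds the determinant by the product of the column lengths, each at most
    [opnorm A]. *)
Lemma det_le_opnorm (A : 'M[R]_2) : `|\det A| <= opnorm A ^+ 2.
Proof.
have H : `|\det A| <= l2norm (col 0 A) * l2norm (col 1 A).
  rewrite -(ler_pXn2r (n := 2)) ?nnegrE ?mulr_ge0 ?l2norm_ge0//.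
  rewrite exprMn !sqr_l2norm real_normK ?num_real// det_mx22 !big_ord_recl !big_ord0.
  rewrite !mxE !addr0 /=.
  have -> : lift ord0 ord0 = 1 :> 'I_2 by exact: val_inj.
  set a := A 0 0; set b := A 0 1; set c := A 1 0; set d := A 1 1.
  rewrite -subr_ge0.
  (* Lagrange's identity: the defect in Hadamard's inequality is the squared inner product of the
     columns [(a, c)] and [(b, d)]. *)
  rewrite (_ : _ - _ = (a * b + c * d) ^+ 2); last by ring.
  exact: sqr_ge0.
apply: le_trans H _; rewrite expr2.
by apply: ler_pM; rewrite ?l2norm_ge0 ?l2norm_col.
Qed.

End OperatorNorm.

(** * The transfer cocycle and convergence to the Lyapunov exponent *)

Section Cocycle.
Variables (R : realType) (f : R -> R) (E alpha : R).
Hypothesis cf : continuous f.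
Hypothesis f2pi : periodic f (2 * pi).
Local Notation Phi := (Phi f E alpha).
Local Notation transfer := (transfer f E alpha).

Lemma transferE theta n :
  [/\ transfer theta n 0 0 = E - potential f alpha theta n,
      transfer theta n 0 1 = -1,
      transfer theta n 1 0 = 1 & transfer theta n 1 1 = 0].
Proof. by rewrite !mxE. Qed.

Lemma mulmx2E (A B : 'M[R]_2) i j :
  (A *m B) i j = A i 0 * B 0 j + A i 1 * B 1 j.
Proof.
rewrite mxE !big_ord_recl big_ord0 addr0.
by congr (_ + A _ _ * B _ _); exact: val_inj.
Qed.

(** Cocycle identity: after [n] steps the potential seen from [theta] is the one seen from the phase
    rotated by [2 * pi * alpha * n]. *)
Lemma Phi_add theta m n :
  Phi theta (m + n) = Phi (theta + 2 * pi * alpha * n%:R) m *m Phi theta n.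
Proof.
elim: m => [|m IH]; first by rewrite mul1mx.
rewrite addSn /= IH mulmxA; congr (_ *m _ *m _).
apply/matrixP => i j; rewrite !mxE /potential.
have -> // : 2 * pi * alpha * (m + n).+1%:R + theta =
  2 * pi * alpha * m.+1%:R + (theta + 2 * pi * alpha * n%:R).
by rewrite -addSn natrD; ring.
Qed.

Lemma det_Phi theta n : \det (Phi theta n) = 1.
Proof.
elim: n => [|n IH]; first exact: det1.
rewrite /= det_mulmx IH mulr1 det_mx22.
by have [-> -> -> ->] := transferE theta n.+1; rewrite mulr0 mulN1r opprK add0r.
Qed.

Lemma Phi_periodic n : periodic (Phi ^~ n) (2 * pi).
Proof.
move=> theta; elim: n => // n /= ->; congr (_ *m _).
by apply/matrixP => i j; rewrite !mxE /potential addrA f2pi.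
Qed.

Lemma Phi_continuous n i j : continuous (fun theta => Phi theta n i j).
Proof.
elim: n i j => [|n IH] i j; first by move=> theta; exact: cvg_cst.
have ct k : continuous (fun t => transfer t n.+1 i k).
  rewrite (_ : (fun t => _) = fun t =>
      nth 0 (nth [::] [:: [:: E - potential f alpha t n.+1; -1];
                          [:: 1; 0]] i) k);
    last by apply/funext => t; rewrite mxE.
  case: i {j} => -[|[|//]] ?; case: k => -[|[|//]] ? t;
    rewrite /=; try exact: cvg_cst.
  apply: cvgB; first exact: cvg_cst.
  apply: (@continuous_comp _ _ _ (fun t => 2 * pi * alpha * n.+1%:R + t) f);
    last exact: cf.
  by apply: cvgD; [exact: cvg_cst | exact: cvg_id].
rewrite (_ : (fun t => _) = fun t =>
    transfer t n.+1 i 0 * Phi t n 0 j + transfer t n.+1 i 1 * Phi t n 1 j);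
  last by apply/funext => t; rewrite -mulmx2E.
by move=> theta; apply: cvgD; apply: cvgM; (exact: ct || exact: IH).
Qed.

(** Comes from determinant 1. It keeps the norm away from the singularity of [ln], so that [lnPhi]
    is continuous as well as nonnegative. *)
Lemma opnorm_Phi_ge1 theta n : 1 <= opnorm (Phi theta n).
Proof.
have := det_le_opnorm (Phi theta n); rewrite det_Phi normr1.
by rewrite -[in leLHS](expr1n _ 2) ler_pXn2r ?nnegrE ?opnorm_ge0.
Qed.

Definition lnPhi n theta := ln (opnorm (Phi theta n)).

Lemma lnPhi_ge0 n theta : 0 <= lnPhi n theta.
Proof. exact/ln_ge0/opnorm_Phi_ge1. Qed.

Lemma expR_lnPhi n theta : expR (lnPhi n theta) = opnorm (Phi theta n).
Proof. by rewrite lnK// posrE (lt_le_trans ltr01)// opnorm_Phi_ge1. Qed.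

Lemma lnPhi_continuous n : continuous (lnPhi n).
Proof.
move=> theta; apply: (@continuous_comp _ _ _ (fun t => opnorm (Phi t n)) (@ln R)).
  by apply: opnorm_continuous => i j; exact: Phi_continuous.
by apply: continuous_ln; rewrite (lt_le_trans ltr01)// opnorm_Phi_ge1.
Qed.

Lemma lnPhi_periodic n : periodic (lnPhi n) (2 * pi).
Proof. by move=> theta; rewrite /lnPhi Phi_periodic. Qed.

Lemma lnPhi_subadd m n theta :
  lnPhi (m + n) theta <= lnPhi m (theta + 2 * pi * alpha * n%:R) + lnPhi n theta.
Proof. by rewrite -ler_expR expRD !expR_lnPhi Phi_add opnorm_mulmx. Qed.

Let u n :=
  (2 * pi)^-1 * \int[lebesgue_measure]_(theta in `[0, 2 * pi]) lnPhi n theta.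

(** Integrating [lnPhi_subadd] over a period makes [u] subadditive, because the rotation of the
    phase does not change the integral of a periodic function. *)
Lemma lyapunov_seq_cvg : cvgn (lyapunov_seq f E alpha).
Proof.
have pi0 := @pi_gt0 R.
have pi20 : 0 < 2 * pi :> R by rewrite mulr_gt0.
rewrite -[lyapunov_seq f E alpha]/(fun n => n%:R^-1 * u n).
apply: fekete => [n|m n].
  rewrite mulr_ge0 ?invr_ge0 ?(ltW pi20)//.
  by apply: Rintegral_ge0 => theta _; exact: lnPhi_ge0.
rewrite /u -mulrDr ler_pM2l ?invr_gt0//.
set s := 2 * pi * alpha * n%:R.
have cs : continuous (fun x : R => lnPhi m (x + s)).
  move=> x; apply: (@continuous_comp _ _ _ (fun x => x + s) (lnPhi m)).
    by apply: cvgD; [exact: cvg_id | exact: cvg_cst].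
  exact: lnPhi_continuous.
have := Rintegral_itv_shift s (@lnPhi_continuous m) (ltW pi20).
rewrite add0r (addrC _ s) (Rintegral_periodic s (@lnPhi_continuous m) pi20
  (@lnPhi_periodic m)) => <-.
rewrite -RintegralD//; try exact: continuous_itv_integrable.
  apply: le_Rintegral_itv.
  - exact: lnPhi_continuous.
  - move=> x; apply: cvgD; [exact: cs | exact: lnPhi_continuous].
  - by move=> x _; exact: lnPhi_subadd.
by apply: continuous_itv_integrable; exact: lnPhi_continuous.
Qed.

Lemma lyapunov_ge L :
  (forall n, n%:R * L <= u n) -> L <= lyapunov f E alpha.
Proof.
move=> uL; apply: limr_ge; first exact: lyapunov_seq_cvg.
near=> n.
(* The index 0 is excluded because there the inverse of [n] takes its default value 0. *)
have n0 : 0 < n%:R :> R by rewrite ltr0n; near: n; exact: nbhs_infty_gt.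
by rewrite -[leRHS]/(n%:R^-1 * u n) ler_pdivlMl.
Unshelve. all: by end_near.
Qed.

End Cocycle.

(** * Herman's polynomial and the Jensen-type lower bound *)

Section TrigonometricPotential.
Variables (R : realType) (d : nat) (a : int -> R[i]) (f : R -> R).
Hypothesis hd : (1 <= d)%N.
Hypothesis ha : forall k : int, - d%:Z <= k <= d%:Z -> a (- k) = (a k)^*.
Hypothesis hf : forall t : R, (f t)%:C = trig_poly d a t.
Variables (alpha E : R).
Local Notation Phi := (Phi f E alpha).

Lemma expi_periodic : periodic (@expi R) (2 * pi).
Proof. by move=> t; rewrite expiD expi2pi mulr1. Qed.

Lemma trig_periodic : periodic f (2 * pi).
Proof.
move=> t; suff : (f (t + 2 * pi))%:C = (f t)%:C by case.
rewrite !hf; apply: eq_bigr => j _ /=.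
by rewrite mulrDr (periodicz _ expi_periodic).
Qed.

(** [hf] is an identity in [R[i]]; its real part writes [f] as a finite sum of cosines and sines. *)
Lemma trig_continuous : continuous f.
Proof.
have -> : f = fun t => \sum_(j < (2 * d).+1)
    (complex.Re (a (j%:Z - d%:Z)) * cos ((j%:Z - d%:Z)%:~R * t) -
     complex.Im (a (j%:Z - d%:Z)) * sin ((j%:Z - d%:Z)%:~R * t)).
  apply/funext => t; rewrite -[LHS]/(complex.Re (f t)%:C) hf.
  rewrite /trig_poly (big_morph (@complex.Re R) (id1 := 0) (op1 := +%R)) //;
    last by case=> ? ? [].
  by apply: eq_bigr => j _; case: (a _).
apply: continuous_big => [|j _]; first exact: add_continuous.
move=> t.
have cl : {for t, continuous (fun t : R => (j%:Z - d%:Z)%:~R * t : R)}.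
  by apply: cvgM; [exact: cvg_cst | exact: cvg_id].
apply: cvgB; apply: cvgM; try exact: cvg_cst.
  exact: continuous_comp cl (@continuous_cos R _).
exact: continuous_comp cl (@continuous_sin R _).
Qed.

(** The potential at site [n] times [z ^+ d], as a polynomial in [z = expi theta]: the shift by [d]
    clears negative frequencies, and the coefficients absorb the rotation by
    [2 * pi * alpha * n]. *)
Let W n : {poly R[i]} := \poly_(j < (2 * d).+1)
  (a (j%:Z - d%:Z) * expi ((j%:Z - d%:Z)%:~R * (2 * pi * alpha * n%:R))).

Lemma W_expi n theta :
  (W n).[expi theta] = expi theta ^+ d * (potential f alpha theta n)%:C.
Proof.
rewrite horner_poly hf mulr_sumr; apply: eq_bigr => j _ /=.
rewrite [RHS]mulrCA -[LHS]mulrA; congr (_ * _).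
rewrite (mulrDr _ _ theta) expiD [RHS]mulrCA; congr (_ * _).
rewrite -!expiMn -expiD -mulrDl; congr (expi (_ * _)).
by rewrite intrB addrC subrK.
Qed.

(** The constant coefficient is [a (- d)] times a unimodular phase, and [a (- d)] is the conjugate
    of [a d]. *)
Lemma normr_W0 n : `|(W n).[0]| = `|a d%:Z|.
Proof.
rewrite horner_coef0 coef_poly/= sub0r normrM normr_expi mulr1.
by rewrite ha ?normcJ// lexx andbT -subr_ge0 opprK.
Qed.

(* [expi theta ^+ (n * d)] times the first column of [Phi theta n] is
   polynomial in [expi theta]. *)
Lemma Phi_poly n : exists X Y : {poly R[i]},
  [/\ `|X.[0]| = `|a d%:Z| ^+ n,
      forall theta,
        X.[expi theta] = expi theta ^+ (n * d) * (Phi theta n 0 0)%:C &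
      forall theta,
        Y.[expi theta] = expi theta ^+ (n * d) * (Phi theta n 1 0)%:C].
Proof.
elim: n => [|n [X [Y [X0 HX HY]]]].
  exists 1, 0; split; first by rewrite hornerC normr1.
    by move=> theta; rewrite hornerC mxE mul0n mul1r.
  by move=> theta; rewrite hornerC mxE mulr0.
(* The new transfer matrix, multiplied by [z ^+ d], applied to the column [(X, Y)]. The polynomial
   [Y] is carried along to close the induction. *)
exists ((E%:C *: 'X^d - W n.+1) * X - 'X^d * Y), ('X^d * X); split.
(* As [d] is positive, the terms containing ['X^d] vanish at 0 and only [- W n.+1 * X]
   contributes. *)
- rewrite !(hornerE, hornerXn) expr0n eqn0Ngt hd/= mulr0 mul0r subr0 add0r.
  by rewrite normrM normrN normr_W0 X0 -exprS.
- move=> theta; rewrite /= mulmx2E.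
  have [-> -> _ _] := transferE f E alpha theta n.+1.
  rewrite !(hornerE, hornerXn) HX HY W_expi mulSn exprD.
  by rewrite mulN1r rmorphB/= rmorphM/= rmorphB/=; ring.
- move=> theta; rewrite /= mulmx2E.
  have [_ _ -> ->] := transferE f E alpha theta n.+1.
  by rewrite mul1r mul0r addr0 !(hornerE, hornerXn) HX mulSn exprD mulrA.
Qed.

Lemma lnPhi_mean_ge n : 0 < ComplexField.Normc.normc (a d%:Z) ->
  2 * pi * (n%:R * ln (ComplexField.Normc.normc (a d%:Z))) <=
  \int[lebesgue_measure]_(theta in `[0, 2 * pi]) lnPhi f E alpha n theta.
Proof.
set A := ComplexField.Normc.normc _ => A0; have pi0 := @pi_gt0 R.
apply: Rintegral_periodic_ge.
- exact: lnPhi_continuous trig_continuous n.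
- by rewrite mulr_gt0.
- exact: lnPhi_periodic trig_periodic n.
move=> N N0; set h := _ / _.
have [X [Y [X0 HX _]]] := Phi_poly n.
have [t Xt] := poly_prod_rotation X N h; exists t.
(* Exponentiating turns the sum into a product of norms, so no logarithm of [X], which may vanish on
   the circle, is ever taken. *)
rewrite -ler_expR expRM_natl expRM_natl lnK ?posrE// expR_sum.
(* The comparison moves to [R[i]], where the modulus of a complex number takes its values; [normc]
   is its real-valued form. *)
rewrite -lecR rmorphXn/= rmorphXn/= rmorph_prod/= -X0 (le_trans Xt)//.
apply: ler_prod => k _; rewrite normr_ge0/= HX normrM normrX normr_expi.
rewrite expr1n mul1r.
by rewrite expR_lnPhi normc_def/= expr0n addr0 sqrtr_sqr lecR opnorm_entry.
Qed.

End TrigonometricPotential.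

Theorem proposition5p1 (R : realType) (d : nat) (a : int -> R[i]) (f : R -> R)
    (hd : (1 <= d)%N)
    (ha : forall k : int, - d%:Z <= k <= d%:Z -> a (- k) = (a k)^*)
    (hf : forall t : R, (f t)%:C = trig_poly d a t)
    (alpha : R) (halpha : irrational alpha) (E : R) :
  lnp (ComplexField.Normc.normc (a d%:Z)) <= lyapunov f E alpha.
Proof.
have cf := trig_continuous hf; have f2pi := trig_periodic hf.
have pi20 : 0 < 2 * pi :> R by rewrite mulr_gt0// pi_gt0.
(* This settles both the 0 inside the maximum of [lnp] and the case [a d = 0], where [lnp] is 0 by
   convention. *)
have ge0 : 0 <= lyapunov f E alpha.
  apply: lyapunov_ge => // n; rewrite mulr0 mulr_ge0 ?invr_ge0 ?(ltW pi20)//.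
  by apply: Rintegral_ge0 => theta _; exact: lnPhi_ge0.
rewrite /lnp; case: ifPn => // A0; rewrite ge_max ge0 andbT.
apply: lyapunov_ge => // n; rewrite ler_pdivlMl//.
exact: lnPhi_mean_ge.
Qed.
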